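(* Let $h$ be the hazard rate function of the $\mathrm{EGLFR}(\alpha,\beta,a,b)$ distribution. If $\beta\ge1$ and $\alpha\ge1$, then $h$ is an increasing function on the support $(0,\psi)$.
   Context: Let $\alpha>0$, $\beta\in\mathbb{R}$, $a\ge0$, $b\ge0$ with $a+b>0$, and put $z=ax+\frac b2x^2$. For $\beta>0$, the extended generalized linear failure rate distribution $\mathrm{EGLFR}(\alpha,\beta,a,b)$ has cumulative distribution function $F(x)=\left(1-(1-\beta z)^{1/\beta}\right)^{\alpha}$ on its support $(0,\psi)$, where $\psi=\frac1b\sqrt{a^2+\frac{2b}{\beta}}-\frac ab$ if $b\ne0$ and $\psi=\frac1{a\beta}$ if $b=0$. Its hazard rate function is $$h(x)=\frac{F'(x)}{1-F(x)}=\frac{\alpha(a+bx)(1-\beta z)^{\frac1\beta-1}\left(1-(1-\beta z)^{1/\beta}\right)^{\alpha-1}}{1-\left(1-(1-\beta z)^{1/\beta}\right)^{\alpha}},\qquad 0<x<\psi.$$ *)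

(* Defs.v *)
From mathcomp Require Import all_boot all_order all_algebra.
From mathcomp Require Import all_classical all_reals all_analysis.
Set Implicit Arguments.
Unset Strict Implicit.
Unset Printing Implicit Defensive.
Import Order.TTheory GRing.Theory Num.Theory.
Import numFieldNormedType.Exports.
Local Open Scope ring_scope.

Definition hazard_rate (R : realType) (F : R -> R) (x : R) : R :=
  derive1 F x / (1 - F x).

Definition eglfr_z (R : realType) (a b x : R) : R :=
  a * x + b / 2 * x ^+ 2.

(* Right end point of the support when 0 < beta: the positive root of
   beta * eglfr_z a b x = 1. *)
Definition eglfr_psi (R : realType) (beta a b : R) : R :=
  if b == 0 then (a * beta)^-1
  else b^-1 * Num.sqrt (a ^+ 2 + 2 * b / beta) - a / b.

(* The distribution function on the whole line, for 0 < beta.  On the support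
   both powers have a positive base, so powR is the usual real power. *)
Definition eglfr_cdf (R : realType) (alpha beta a b x : R) : R :=
  if x <= 0 then 0
  else if x < eglfr_psi beta a b then
    (1 - (1 - beta * eglfr_z a b x) `^ (beta^-1)) `^ alpha
  else 1.

(* Main.v *)
(** With [w = 1 - beta z] and [t = 1 - w^(1/beta)], the hazard rate is the
    product of [alpha], [a + b x], [w^(1/beta - 1)], [t^(alpha - 1)] and
    [(1 - t^alpha)^-1], all positive.  As [x] grows, [w] decreases and [t]
    increases; since [1/beta - 1 <= 0 <= alpha - 1], every factor is
    nondecreasing, and the last one is strictly increasing. *)
Require Import Defs.
From mathcomp Require Import all_boot all_order all_algebra.
From mathcomp Require Import all_classical all_reals all_analysis.
From mathcomp Require Import ring lra.
Import Order.TTheory GRing.Theory Num.Theory.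
Import numFieldNormedType.Exports.
Local Open Scope ring_scope.

Lemma eglfr_z_gt0 {R : realType} {a b x : R} :
  0 <= a -> 0 <= b -> 0 < a + b -> 0 < x -> 0 < eglfr_z a b x.
Proof.
rewrite /eglfr_z => a0 b0 ab0 x0.
have [a_gt0|a_le0] := ltrP 0 a.
  by apply: ltr_pwDl; rewrite ?mulr_gt0// mulr_ge0 ?divr_ge0 ?sqr_ge0.
by apply: ltr_wpDl; rewrite ?mulr_ge0 ?(ltW x0)// mulr_gt0 ?exprn_gt0//; lra.
Qed.

Lemma ltr_eglfr_z {R : realType} {a b x y : R} :
  0 <= a -> 0 <= b -> 0 < a + b -> 0 < x -> x < y ->
  eglfr_z a b x < eglfr_z a b y.
Proof.
move=> a0 b0 ab0 x0 xy; rewrite -subr_gt0.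
(* The increment is again a value of [eglfr_z], at [y - x], plus the nonnegative cross term left
   over from the square; positivity of [eglfr_z] then suffices. *)
have -> : eglfr_z a b y - eglfr_z a b x =
    eglfr_z a b (y - x) + b * x * (y - x) by rewrite /eglfr_z; field.
have yx0 : 0 < y - x by rewrite subr_gt0.
by rewrite ltr_pwDl ?eglfr_z_gt0// !mulr_ge0// ltW.
Qed.

(** Keeps the base [1 - beta * eglfr_z a b x] positive on the support, which is what differentiating
    [powR] there requires. For [b = 0] the bound is linear in [x]; otherwise it is [b * x + a]
    against a square root, and both sides can be squared. *)
Lemma mul_eglfr_z_lt1 {R : realType} {beta a b x : R} :
  0 < beta -> 0 <= a -> 0 <= b -> 0 < a + b ->
  0 < x -> x < eglfr_psi beta a b -> beta * eglfr_z a b x < 1.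
Proof.
rewrite /eglfr_psi /eglfr_z => beta0 a0 b0 ab0 x0.
case: eqP => [b_eq0|/eqP b_neq0] x_psi.
  rewrite b_eq0 addr0 in ab0.
  have -> : beta * (a * x + b / 2 * x ^+ 2) = x * (a * beta).
    by rewrite b_eq0; field.
  by rewrite -ltr_pdivlMr ?mulr_gt0// div1r.
have b_gt0 : 0 < b by rewrite lt_neqAle eq_sym b_neq0.
have d_ge0 : 0 <= a ^+ 2 + 2 * b / beta.
  by rewrite addr_ge0 ?sqr_ge0// divr_ge0 ?mulr_ge0// ltW.
have : b * x + a < Num.sqrt (a ^+ 2 + 2 * b / beta).
  have := x_psi; rewrite -(ltr_pM2l b_gt0) mulrBr mulVKf// mulrCA mulfV// mulr1.
  by rewrite ltrBrDr.
rewrite -(ltr_pXn2r (ltn0Sn 1)) ?nnegrE ?sqrtr_ge0 ?addr_ge0 ?mulr_ge0 ?(ltW x0)//.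
rewrite sqr_sqrtr// -subr_gt0 => d_gt0.
rewrite -subr_gt0.
(* Completing the square: the second factor is the difference of squares just shown to be
   positive. *)
have -> : 1 - beta * (a * x + b / 2 * x ^+ 2) = (beta / (2 * b)) *
   (a ^+ 2 + 2 * b / beta - (b * x + a) ^+ 2).
  by field; rewrite b_neq0 gt_eqF.
by rewrite mulr_gt0// divr_gt0// mulr_gt0.
Qed.

Lemma powR_lt1 {R : realType} {p t : R} : 0 < p -> 0 <= t -> t < 1 -> t `^ p < 1.
Proof.
move=> p0 t0 t1; have := gt0_ltr_powR p0 _ _ t1.
by rewrite powR1; apply; rewrite nnegrE.
Qed.

(** Chain rule through [W] and then [T]; both powers have a positive base at [x], and the factor
    [beta] coming from [W] cancels the exponent [beta^-1] brought down by the inner power. *)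
Lemma is_derive_eglfr_cdf {R : realType} (alpha : R) {beta a b x : R} :
  0 <= a -> 0 <= b -> 0 < a + b -> 0 < beta ->
  0 < x -> x < eglfr_psi beta a b ->
  let w := 1 - beta * eglfr_z a b x in
  is_derive x 1 (eglfr_cdf alpha beta a b)
    (alpha * (1 - w `^ beta^-1) `^ (alpha - 1) *
     (w `^ (beta^-1 - 1) * (a + b * x))).
Proof.
move=> a0 b0 ab0 beta0 x0 x_psi w.
have z0 := eglfr_z_gt0 a0 b0 ab0 x0.
have z1 := mul_eglfr_z_lt1 beta0 a0 b0 ab0 x0 x_psi.
have w0 : 0 < w by rewrite subr_gt0.
have t0 : 0 < 1 - w `^ beta^-1.
  by rewrite subr_gt0 powR_lt1 ?invr_gt0 ?(ltW w0)// ltrBlDr ltrDl mulr_gt0.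
pose W y := 1 - beta * eglfr_z a b y.
have dw : is_derive x 1 W
    (- (beta * (a + b * x))).
  rewrite /W /eglfr_z; apply: is_derive_eq.
  by rewrite /GRing.scale/=; field.
have dpow := @is_derive1_comp _ (@powR R ^~ beta^-1) W x _ _
  (is_derive1_powR _ w0) dw.
pose T y := 1 - W y `^ beta^-1.
have dt : is_derive x 1 T
    (w `^ (beta^-1 - 1) * (a + b * x)).
  apply: (is_derive_eq (is_deriveB (is_derive_cst (1 : R) x 1) dpow)).
  by rewrite /w; field; rewrite gt_eqF.
have := @is_derive1_comp _ (@powR R ^~ alpha) T x _ _
  (is_derive1_powR alpha t0) dt.
(* The support is open, so the piecewise distribution function agrees with its middle branch on a
   neighbourhood of [x], and the derivative carries over. *)
apply: near_eq_is_derive.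
have : x \in `]0, eglfr_psi beta a b[ by rewrite in_itv/= x0.
move=> /near_in_itvoo; apply: filterS => y.
by rewrite in_itv/= /eglfr_cdf => /andP[y0 ->]; rewrite leNgt y0.
Qed.

(** The constant [alpha] stands in front so that it cancels when hazard rates at two points are
    compared. *)
Lemma hazard_rate_eglfr_cdf {R : realType} (alpha : R) {beta a b x : R} :
  0 <= a -> 0 <= b -> 0 < a + b -> 0 < beta ->
  0 < x -> x < eglfr_psi beta a b ->
  let w := 1 - beta * eglfr_z a b x in
  let t := 1 - w `^ beta^-1 in
  hazard_rate (eglfr_cdf alpha beta a b) x =
    alpha * ((a + b * x) * w `^ (beta^-1 - 1) * t `^ (alpha - 1)
             / (1 - t `^ alpha)).
Proof.
move=> a0 b0 ab0 beta0 x0 x_psi w t.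
rewrite /hazard_rate derive1E.
rewrite (@derive_val _ _ _ _ _ _ _
  (is_derive_eglfr_cdf alpha a0 b0 ab0 beta0 x0 x_psi)).
rewrite /eglfr_cdf leNgt x0/= x_psi -/w -/t; ring.
Qed.

Theorem theorem2p6 (R : realType) (alpha beta a b : R)
    (ha : 0 <= a) (hb : 0 <= b) (hab : 0 < a + b)
    (hbeta : 1 <= beta) (halpha : 1 <= alpha) :
  {in `]0, eglfr_psi beta a b[ &,
    {homo hazard_rate (eglfr_cdf alpha beta a b) : x y / x < y}}.
Proof.
have beta0 : 0 < beta := lt_le_trans ltr01 hbeta.
have alpha0 : 0 < alpha := lt_le_trans ltr01 halpha.
have betaV0 : 0 < beta^-1 by rewrite invr_gt0.
move=> x y; rewrite !in_itv/= => /andP[x0 x_psi] /andP[y0 y_psi] xy.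
rewrite !hazard_rate_eglfr_cdf// ltr_pM2l//.
have zx0 := eglfr_z_gt0 ha hb hab x0.
have zxy := ltr_eglfr_z ha hb hab x0 xy.
have zy1 := mul_eglfr_z_lt1 beta0 ha hb hab y0 y_psi.
set wx := 1 - beta * eglfr_z a b x; set wy := 1 - beta * eglfr_z a b y.
have wy0 : 0 < wy by rewrite subr_gt0.
have wyx : wy < wx by rewrite ltrD2l ltrN2 ltr_pM2l.
have wx0 := lt_trans wy0 wyx.
have wx1 : wx < 1 by rewrite ltrBlDr ltrDl mulr_gt0.
clearbody wx wy.
set tx := 1 - wx `^ beta^-1; set ty := 1 - wy `^ beta^-1.
have tx0 : 0 < tx by rewrite subr_gt0 powR_lt1// ltW.
have txy : tx < ty by rewrite ltrD2l ltrN2 gt0_ltr_powR// nnegrE ltW.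
have ty0 := lt_trans tx0 txy.
have ty1 : ty < 1 by rewrite ltrBlDr ltrDl powR_gt0.
clearbody tx ty.
have Fxy : tx `^ alpha < ty `^ alpha by rewrite gt0_ltr_powR// nnegrE ltW.
have Sy0 : 0 < 1 - ty `^ alpha by rewrite subr_gt0 powR_lt1// ltW.
have Sx0 : 0 < 1 - tx `^ alpha by rewrite (lt_trans Sy0) ?ltrD2l ?ltrN2.
have bx0 : 0 < a + b * x by nra.
have bxy : a + b * x <= a + b * y by rewrite lerD2l ler_wpM2l// ltW.
(* The exponent is nonpositive: pass to inverses of powers with exponent [1 - beta^-1], which is
   nonnegative because [1 <= beta]. *)
have wxy : wx `^ (beta^-1 - 1) <= wy `^ (beta^-1 - 1).
  rewrite -opprB !powRN lef_pV2 ?posrE ?powR_gt0//.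
  rewrite ge0_ler_powR ?nnegrE ?(ltW wy0) ?(ltW wx0) ?(ltW wyx)//.
  by rewrite subr_ge0 invf_le1.
have tpxy : tx `^ (alpha - 1) <= ty `^ (alpha - 1).
  by rewrite ge0_ler_powR ?nnegrE ?subr_ge0 ?(ltW tx0) ?(ltW ty0) ?(ltW txy).
(* The intermediate value changes only the denominator. Strictness has to come from there, since the
   other factors can all be constant, as for [alpha = beta = 1] and [b = 0]; they are compared
   weakly afterwards. *)
apply: lt_le_trans (_ : (a + b * x) * wx `^ (beta^-1 - 1) *
    tx `^ (alpha - 1) / (1 - ty `^ alpha) <= _).
  rewrite ltr_pM2l; last by rewrite !mulr_gt0 ?powR_gt0.
  by rewrite ltf_pV2 ?posrE// ltrD2l ltrN2.
rewrite ler_pM2r ?invr_gt0//.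
by rewrite !ler_pM ?mulr_ge0 ?powR_ge0 ?(ltW bx0).
Qed.
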